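(* Let $P(t)\in\mathbb{C}[[t]]$ be a tame power series. Suppose there exists an isolated point $a$ of $\Omega(P)$ which is periodic with respect to the $\tau_\Omega$-action on $\Omega(P)$ (i.e. $\tau_\Omega^h(a)=a$ for some $h\in\mathbb{Z}_{>0}$). Then $\Omega(P)$ is a finite rational accumulation set, whose period $h_P$ is equal to $\#\Omega(P)$. Furthermore, $\Omega(P)$ coincides with the $\tau_\Omega$-orbit of $a$, and there is a natural bijection $$\mathbb{Z}/h_P\mathbb{Z}\;\simeq\;\Omega(P),\qquad e\bmod h_P\;\mapsto\; a^{[e]}:=\lim_{n\to\infty}X_{e+h_P\cdot n}(P),$$ where the standard partition $\mathcal{U}_{h_P}=\{U^{[e]}\}_{[e]\in\mathbb{Z}/h_P\mathbb{Z}}$ of $\mathbb{Z}_{\ge0}$ is (up to finite sets) the exact partition for the accumulation of $\{X_n(P)\}$ to $\Omega(P)$. The shift $[e]\mapsto[e-1]$ on the left-hand side corresponds to the action of $\tau_\Omega$ on the right-hand side.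
   Context: A power series $P(t)=\sum_{n\ge0}\gamma_nt^n\in\mathbb{C}[[t]]$ is tame if there are $u,v\in\mathbb{R}_{>0}$ with $u\le|\gamma_{n-1}/\gamma_n|\le v$ for all sufficiently large $n$. Then $\gamma_n\ne0$ for $n\ge N_P$ (some $N_P$), and for such $n$ set $X_n(P):=\sum_{k=0}^n\frac{\gamma_{n-k}}{\gamma_n}s^k$. Equip $\mathbb{C}[[s]]$ with the topology of coefficientwise convergence. $\Omega(P)\subset\mathbb{C}[[s]]$ is the set of accumulation points (limits of subsequences) of $\{X_n(P)\}_{n\ge N_P}$; it is a non-empty compact set. For $a=\sum_k a_ks^k\in\Omega(P)$ one has $a_0=1$, and $\iota(a):=a_1\neq0$. The map $\tau_\Omega:\Omega(P)\to\Omega(P)$ is $\tau_\Omega(a):=(a-1)/(\iota(a)s)$; equivalently, if $X_{n_m}(P)\to a$ then $X_{n_m-1}(P)\to\tau_\Omega(a)$. A subset $U\subset\mathbb{Z}_{\ge0}$ is rational if $\sum_{n\in U}t^n$ is a rational function; equivalently, there is $h\in\mathbb{Z}_{>0}$ with ($n+h\in U\iff n\in U$) for all large $n$; the least such $h$ is the period of $U$. For $h>0$ put $U^{[e]}:=\{n\in\mathbb{Z}_{\ge0}: n\equiv e \bmod h\}$; $\mathcal{U}_h:=\{U^{[e]}\}_{[e]\in\mathbb{Z}/h\mathbb{Z}}$ is the standard partition of period $h$. A finite rational partition of $\mathbb{Z}_{\ge0}$ is a finite family $\{U_a\}_{a\in\Omega}$ of rational subsets such that for some finite set $D$ one has the disjoint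 decomposition $\mathbb{Z}_{\ge0}\setminus D=\coprod_a(U_a\setminus D)$; its period is the least common multiple of the periods of the $U_a$. A sequence $\{X_n\}$ in a Hausdorff space is finite rationally accumulating if it accumulates to a finite set $\Omega$ such that, for a system of pairwise disjoint open neighbourhoods $\mathcal{V}_a$ of $a\in\Omega$, the sets $U_a:=\{n: X_n\in\mathcal{V}_a\}$ form a finite rational partition; $\Omega$ is then called a finite rational accumulation set and its period is the period of this partition. For $\Omega(P)$ this refers to the sequence $\{X_n(P)\}$. *)

(* Defs.v *)
From HB Require Import structures.
From mathcomp Require Import all_boot all_order all_algebra.
From mathcomp Require Import all_classical all_reals all_analysis.
From mathcomp Require Import complex.

Set Implicit Arguments.
Unset Strict Implicit.
Unset Printing Implicit Defensive.

Import Order.TTheory GRing.Theory Num.Theory.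
Import numFieldNormedType.Exports.

Local Open Scope classical_set_scope.
Local Open Scope ring_scope.
Local Open Scope complex_scope.

(* The usual metric topology of the complex numbers. *)
HB.instance Definition _ (R : realType) := PseudoPointedMetric.copy R[i] R[i]^o.

(* A formal power series is its sequence of coefficients; the product topology
   is that of coefficientwise convergence. *)
Notation fps R := {ptws nat -> R[i]}.

Section RationalSubsets.

(* The generating series sum_(n in U) t^n equals p / q, written as the identity
   q * sum_(n in U) t^n = p between coefficients of t^n. *)
Definition rational_set (U : set nat) : Prop :=
  exists p q : {poly rat}, q != 0 /\
    forall n : nat, \sum_(i < n.+1) q`_i * ((n - i)%N \in U)%:R = p`_n.

Definition eventual_period (U : set nat) (h : nat) : Prop :=
  (0 < h)%N /\ \forall n \near \oo, U (n + h)%N <-> U n.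

(* By convention 0 if U has no eventual period, that is, if U is not
   rational. *)
Definition period (U : set nat) : nat :=
  xget 0%N [set h | eventual_period U h /\
                    forall k, eventual_period U k -> (h <= k)%N].

(* The members of the family are the U a for a in Omega. *)
Definition finite_rational_partition (I : Type) (Omega : set I)
    (U : I -> set nat) : Prop :=
  [/\ finite_set Omega,
      forall a, Omega a -> rational_set (U a) &
      exists D : set nat,
        [/\ finite_set D,
            trivIset Omega (fun a => U a `\` D) &
            ~` D = \bigcup_(a in Omega) (U a `\` D)]].

Definition partition_period (I : choiceType) (Omega : set I)
    (U : I -> set nat) : nat :=
  \big[lcmn/1%N]_(a \in Omega) period (U a).

Definition standard_class (h e : nat) : set nat := [set n | n = e %[mod h]].

Definition eq_up_to_finite (A B : set nat) : Prop :=
  exists2 D : set nat, finite_set D & A `\` D = B `\` D.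

End RationalSubsets.

Section Accumulation.
Variables (T : topologicalType) (X : nat -> T).

Definition accumulation_points : set T :=
  [set a | exists2 phi : nat -> nat, increasing_seq phi &
             (X \o phi) m @[m --> \oo] --> a].

Definition disjoint_open_nbhs (Omega : set T) (V : T -> set T) : Prop :=
  (forall a, Omega a -> open_nbhs a (V a)) /\ trivIset Omega V.

(* Omega is a finite rational accumulation set of X, of period h. *)
Definition finite_rational_accumulation (Omega : set T) (h : nat) : Prop :=
  [/\ finite_set Omega,
      accumulation_points = Omega &
      exists V : T -> set T,
        [/\ disjoint_open_nbhs Omega V,
            finite_rational_partition Omega (fun a => X @^-1` V a) &
            partition_period Omega (fun a => X @^-1` V a) = h]].

End Accumulation.

Section OppositeSeries.
Variable R : realType.

(* The lower bound forces P n.-1 and P n to be nonzero for large n, since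
   x / 0 = 0. *)
Definition tame (P : fps R) : Prop :=
  exists u v : R, [/\ 0 < u, 0 < v &
    \forall n \near \oo, u%:C <= `|P n.-1 / P n| <= v%:C].

(* Only meaningful when P n != 0. For tame P this excludes finitely many n, and
   neither accumulation points nor index sets up to finite sets depend on
   them. *)
Definition opposite_seq (P : fps R) (n : nat) : fps R :=
  fun k => if (k <= n)%N then P (n - k)%N / P n else 0.

Definition Omega (P : fps R) : set (fps R) :=
  accumulation_points (opposite_seq P).

(* (a - 1) / (a_1 s): since a_0 = 1 for a in Omega P, dividing a - 1 by s
   shifts the coefficients of a. *)
Definition tau (a : fps R) : fps R := fun k => a k.+1 / a 1%N.

End OppositeSeries.

(* Main.v *)
Require Import Defs.
From HB Require Import structures.
From mathcomp Require Import all_boot all_order all_algebra.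
From mathcomp Require Import finmap ring lra zify.
From mathcomp Require Import all_classical all_reals all_analysis.
From mathcomp Require Import complex.

Set Implicit Arguments.
Unset Strict Implicit.
Unset Printing Implicit Defensive.

Import Order.TTheory GRing.Theory Num.Theory.
Import numFieldNormedType.Exports.

Local Open Scope classical_set_scope.
Local Open Scope ring_scope.

(* A limit of X_n along a subsequence is mapped by tau to the limit of X_(n-1),
   since tau X_n = X_(n-1).  Choose a neighbourhood V of the isolated point a
   whose closure meets Omega only at a.  By compactness X_n tends to a along
   {n | X_n in V}, so X_(n-h) tends to tau^h a = a along that set, and hence
   lies in V for large n.  Thus {n | X_n in V} is eventually closed under
   n |-> n - h, and, being infinite, it eventually contains a residue class mod
   h.  Along that class X_n tends to a, and applying powers of tau gives the
   limits along the other classes; these are the points of the orbit of a, and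
   they are pairwise distinct when h is the least period of a. *)

(** * Eventually periodic sets of integers *)

Section EventualPeriods.

(** Multiplying the generating series by [1 - 'X^h] turns its coefficients into differences of
    membership at [n] and [n - h]. These vanish from [N + h] on, so the product is a polynomial. *)
Lemma rational_eventual_period (U : set nat) (h : nat) :
  eventual_period U h -> rational_set U.
Proof.
case=> h0 [N _ HN].
pose q : {poly rat} := 1 - 'X^h.
pose c n := \sum_(i < n.+1) q`_i * ((n - i)%N \in U)%:R.
have sum_eq (F : nat -> rat) n k : (k <= n)%N ->
    \sum_(i < n.+1) (i == k :> nat)%:R * F i = F k.
  move=> kn; have kn1 : (k < n.+1)%N by [].
  rewrite (bigD1 (Ordinal kn1)) //= eqxx mul1r big1 ?addr0// => i ik.
  by rewrite (negbTE (_ : i != k :> nat)) ?mul0r.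
exists (\poly_(n < N + h) c n), q; split.
  apply/eqP => /(congr1 (fun p : {poly rat} => p`_0)).
  by rewrite coefB coef1 coefXn coef0 eqxx eq_sym (gtn_eqF h0) subr0;
    apply/eqP; rewrite oner_eq0.
move=> n; rewrite -/(c n) coef_poly; case: ltnP => // Nn.
have hn : (h <= n)%N by rewrite (leq_trans _ Nn) ?leq_addl.
rewrite /c; under eq_bigr do rewrite coefB coef1 coefXn mulrBl.
rewrite sumrB (sum_eq (fun i => ((n - i)%N \in U)%:R)) //.
rewrite (sum_eq (fun i => ((n - i)%N \in U)%:R)) // subn0.
have Nnh : (N <= n - h)%N by rewrite leq_subRL // addnC.
have := HN _ Nnh; rewrite /= subnK // => UU.
by rewrite (_ : (n \in U) = ((n - h)%N \in U)) ?subrr//; apply/idP/idP;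
  rewrite !inE => /UU.
Qed.

Lemma eventual_period_standard (U : set nat) (h e : nat) : (0 < h)%N ->
  (\forall n \near \oo, U n <-> standard_class h e n) -> eventual_period U h.
Proof.
move=> h0 [N _ HN]; split=> //; exists N => // n Nn /=.
by rewrite (HN _ Nn) HN /standard_class /= ?modnDr // (leq_trans Nn) ?leq_addr.
Qed.

Lemma period_standard (U : set nat) (h e : nat) : (0 < h)%N ->
  (\forall n \near \oo, U n <-> standard_class h e n) -> period U = h.
Proof.
move=> h0 Uh; have hU := eventual_period_standard h0 Uh.
have h_min k : eventual_period U k -> (h <= k)%N.
  case=> k0 [M _ HM]; case: Uh => N _ HN.
  (* A member of the class beyond both thresholds: if [k] is a period, then [n + k] lies in the
     class too, so [h] divides [k]. *)
  pose n := (e + h * (M + N))%N.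
  have [Mn Nn] : (M <= n)%N /\ (N <= n)%N.
    split; rewrite /n (leq_trans _ (leq_addl _ _)) //;
      by rewrite (leq_trans _ (leq_pmull _ h0)) ?leq_addr ?leq_addl.
  have en : n = e %[mod h] by rewrite /n addnC mulnC modnMDl.
  have /HM := Mn; rewrite /= (HN _ Nn) HN /standard_class /=; last first.
    by rewrite (leq_trans Nn) ?leq_addr.
  move=> [_ /(_ en)]; rewrite -en -[in RHS](addn0 n) => /eqP.
  by rewrite eqn_modDl mod0n; exact: dvdn_leq.
apply: xget_unique => [//|k [hk /(_ h hU) kh]].
by apply/eqP; rewrite eqn_leq kh h_min.
Qed.

Lemma biglcmn_const (I : Type) (s : seq I) (h : nat) : (0 < size s)%N ->
  \big[lcmn/1%N]_(i <- s) h = h.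
Proof.
rewrite big_const_seq count_predT; case: (size s) => // n _.
by elim: n => [|n IHn]; rewrite iterS ?lcmn1 // IHn (lcmn_idPl (dvdnn h)).
Qed.

Lemma partition_period_const (I : choiceType) (Om : set I) (U : I -> set nat)
    (h : nat) : finite_set Om -> Om !=set0 ->
  (forall a, Om a -> period (U a) = h) -> partition_period Om U = h.
Proof.
move=> finOm [a0 Oma0] Uh; rewrite /partition_period fsbig_finite //=.
have a0s : a0 \in fset_set Om by rewrite in_fset_set // inE.
rewrite big_seq (eq_bigr (fun=> h)) => [|a]; last first.
  by rewrite in_fset_set // inE => /Uh.
rewrite -big_seq biglcmn_const // lt0n size_eq0.
have {}a0s : a0 \in finmap.enum_fset (fset_set Om) := a0s.
by apply: contraTneq a0s => ->.
Qed.

(* Along each class mod h, membership in U propagates downwards, so it holds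
   eventually or fails eventually. *)
Lemma eventually_standard_class (U : set nat) (h : nat) : (0 < h)%N ->
  (\forall n \near \oo, U (n + h)%N -> U n) ->
  ~ (\forall n \near \oo, ~ U n) ->
  exists e, \forall n \near \oo, standard_class h e n -> U n.
Proof.
move=> h0 [N _ HN] Uinf; apply: contrapT => /forallNP noe; apply: Uinf.
have noU (e : 'I_h) : \forall n \near \oo, standard_class h e n -> ~ U n.
  have [m /= [Nm me mU]] : exists m, [/\ (N <= m)%N, m = e %[mod h] & ~ U m].
    apply: contrapT => nom; apply: (noe e); exists N => // m Nm me.
    by apply: contrapT => mU; apply: nom; exists m.
  exists m => // n /= mn ne.
  have /eqP : n = m %[mod h] by rewrite me.
  rewrite eqn_mod_dvd // => /dvdnP[k nmk].
  rewrite -(subnK mn) nmk; elim: k {nmk} => [|k IHk]; first by rewrite add0n.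
  rewrite mulSn -addnA addnC => Ukh; apply: IHk; apply: HN Ukh => /=.
  by rewrite (leq_trans Nm) ?leq_addl.
apply: filterS (filter_forall _ noU) => n /(_ (Ordinal (ltn_pmod n h0))).
by apply; rewrite /standard_class /= modn_mod.
Qed.

Lemma near_eq_up_to_finite (A B : set nat) :
  (\forall n \near \oo, A n <-> B n) -> eq_up_to_finite A B.
Proof.
case=> N _ HN; exists `I_N; first exact: finite_II.
apply/seteqP; split => n [ABn nN]; split=> //; apply/HN => //=;
  by rewrite leqNgt; apply/negP.
Qed.

End EventualPeriods.

(** * Sequences driven backwards by a continuous map *)

Lemma separating_open_nbhs (T : topologicalType) (Om : set T) :
  hausdorff_space T -> finite_set Om -> exists V, disjoint_open_nbhs Om V.
Proof.
rewrite open_hausdorff => sepT finOm.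
have /choice[U UP] : forall p : T * T, exists AB : set T * set T,
    p.1 != p.2 ->
    [/\ AB.1 p.1, AB.2 p.2, open AB.1, open AB.2 & AB.1 `&` AB.2 = set0].
  move=> p; have [pp|/sepT[AB]] := eqVneq p.1 p.2; first by exists (setT, setT).
  by move=> [/set_mem ? /set_mem ?] [? ? /eqP ?]; exists AB.
(* The separations chosen for [(b, c)] and [(c, b)] are unrelated. Using both makes [W b c] a
   neighbourhood of [b] disjoint from [W c b] when [b] and [c] differ. *)
pose W b c := if b == c then setT else (U (b, c)).1 `&` (U (c, b)).2.
exists (fun b => (\bigcap_(c in [set` fset_set Om]) W b c)°); split => [b Omb|].
  split; first exact: open_interior.
  apply: filter_bigI => c _; rewrite /W; case: eqVneq => [_|bc];
    first exact: filterT.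
  have [? _ ? _ _] := UP (b, c) bc; rewrite eq_sym in bc.
  by have [_ ? _ ? _] := UP (c, b) bc; apply: filterI; exact: open_nbhs_nbhs.
apply/trivIsetP => b c Omb Omc bc; rewrite -subset0 => x [].
have [bs cs] : b \in fset_set Om /\ c \in fset_set Om.
  by rewrite !in_fset_set // !inE.
move=> /nbhs_singleton/(_ c cs) + /nbhs_singleton/(_ b bs).
rewrite /W (negbTE bc) eq_sym (negbTE bc) => -[Ux _] [_ Ux'].
by have [_ _ _ _ <-] := UP (b, c) bc.
Qed.

Section Dynamics.
Variables (T : topologicalType) (X : nat -> T) (f : T -> T).
Local Notation Om := (accumulation_points X).
Hypothesis hausT : hausdorff_space T.
Hypothesis regT : regular_space T.
(** Compactness, phrased for filters so that it applies to [\oo] restricted to any infinite set of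
    indices. Continuity of [f] is asked only on [Om] because [tau] divides by a coefficient that may
    vanish elsewhere. *)
Hypothesis X_cluster : forall F : set_system nat, ProperFilter F ->
  F --> \oo -> exists2 b, Om b & cluster (X @ F) b.
Hypothesis f_cont : forall b, Om b -> {for b, continuous f}.
Hypothesis fX : \forall n \near \oo, f (X n.+1) = X n.

Lemma increasing_seq_cvg (phi : nat -> nat) :
  increasing_seq phi -> phi m @[m --> \oo] --> \oo.
Proof.
move=> phi_incr; apply/cvgnyPge => N; exists N => // n /= Nn.
have le_phi k : (k <= phi k)%N.
  elim: k => // k /leq_ltn_trans; apply.
  by rewrite ltnNge (phi_incr k.+1 k : (_ <= _)%N = _) -ltnNge.
exact: leq_trans Nn (le_phi n).
Qed.

Lemma accumulation_cluster b : Om b -> cluster (X @ \oo) b.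
Proof.
move=> [phi /increasing_seq_cvg phioo Xphi] A B XA nB.
have [m [? ?]] : exists m, (A `&` B) (X (phi m)).
  near \oo => m; exists m; split; near: m; first exact: phioo XA.
  exact: Xphi nB.
by exists (X (phi m)).
Unshelve. all: by end_near. Qed.

Lemma cvg_pred (F : set_system nat) (b : T) : Filter F -> F --> \oo ->
  Om b -> X @ F --> b -> X n.-1 @[n --> F] --> f b.
Proof.
move=> FF Foo Omb Xb.
have fXF : \forall n \near F, f (X n) = X n.-1.
  apply: Foo; case: fX => N _ HN; exists N.+1 => // -[//|n] /= Nn.
  exact: HN.
apply: cvg_trans (cvg_comp _ _ Xb (f_cont Omb)).
exact: near_eq_cvg.
Qed.

Lemma accumulation_stable b : Om b -> Om (f b).
Proof.
move=> Omb; have [phi phi_incr Xphi] := Omb.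
have phi_lt m n : (phi m < phi n)%N = (m < n)%N.
  by rewrite !ltnNge (phi_incr n m : (_ <= _)%N = _).
have phi0 m : (0 < phi m.+1)%N by rewrite (leq_ltn_trans (leq0n (phi 0)))
  ?phi_lt.
(* Dropping the first term keeps the indices positive, so that taking predecessors preserves strict
   growth. *)
exists (fun m => (phi m.+1).-1).
  by move=> m n; rewrite leEnat -ltnS !prednK // (phi_incr m.+1 n.+1 : (_ <=
    _)%N = _).
have phiS_incr : increasing_seq (phi \o succn).
  by move=> m n; rewrite /= phi_incr ltnS.
have XphiS : X (phi m.+1) @[m --> \oo] --> b.
  exact: cvg_comp (increasing_seq_cvg (phi := succn) _) Xphi.
exact: (@cvg_pred ((phi \o succn) @ \oo) b _ (increasing_seq_cvg phiS_incr)).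
Qed.

Lemma accumulation_iter k b : Om b -> Om (iter k f b).
Proof. by elim: k => // k IHk Omb; apply/accumulation_stable/IHk. Qed.

Lemma cvg_sub (F : set_system nat) {FF : Filter F} (b : T) k : F --> \oo ->
  Om b -> X @ F --> b -> X (n - k)%N @[n --> F] --> iter k f b.
Proof.
move=> Foo Omb Xb; elim: k => [|k IHk] /=.
  by under eq_fun do rewrite subn0.
under eq_fun do rewrite subnS.
apply: (@cvg_pred ((fun n => n - k)%N @ F)) => //;
  last exact: accumulation_iter.
apply: cvg_trans (cvg_app _ Foo) _; apply/cvgnyPge => N.
by exists (N + k)%N => // n /= Nn; rewrite leq_subRL ?(leq_trans (leq_addl _ _)
  Nn) // addnC.
Qed.

(** Regularity gives [V] with closure in a neighbourhood [W] that meets [Om] only at [a]. If [X @ F]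
    missed a neighbourhood [A] of [a], then [F] restricted to the indices outside [A] would be
    proper. Its image would cluster at a point of [Om] in the closure of [V], hence at [a], although
    it avoids [A]. *)
Lemma isolated_cvg a : isolated Om a -> exists2 V, nbhs a V &
  forall F : set_system nat, Filter F -> F --> \oo ->
    F (X @^-1` V) -> X @ F --> a.
Proof.
move=> [_ [W nW WOm]]; have [V nV VW] := regT nW.
exists V => // F FF Foo FV A nA; apply: contrapT => nFA.
have GF : within (~` (X @^-1` A)) F --> \oo.
  by apply: cvg_trans Foo; exact: cvg_within.
have PG : ProperFilter (within (~` (X @^-1` A)) F).
  apply: Build_ProperFilter => G0; apply: nFA.
  by apply: (@filterS _ F _ _ _ _ G0) => n /= nA'; apply: contrapT => /nA'.
have [b Omb cb] := X_cluster PG GF.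
have ab : b = a.
  suff: (W `&` Om) b by rewrite WOm.
  split=> //; apply: VW => B nB; apply: cb => //.
  by apply: (@filterS _ F _ _ _ _ FV) => n Vn _.
have [z [Az ?]] : ~` A `&` A !=set0; last exact: Az.
by apply: cb; [exact: (@filterE _ F)|rewrite ab].
Qed.


Lemma isolated_periodic_phase a h : isolated Om a -> (0 < h)%N ->
  iter h f a = a -> exists e0, X @ within (standard_class h e0) \oo --> a.
Proof.
move=> isoa h0 fa; have [V nV VF] := isolated_cvg isoa.
have Oma : Om a by case: isoa => /set_mem.
have class_oo (U : set nat) : within U \oo --> \oo by exact: cvg_within.
have XU : X @ within (X @^-1` V) \oo --> a.
  by apply: VF; [exact: class_oo|exact: withinT].
have : X (n - h)%N @[n --> within (X @^-1` V) \oo] --> iter h f a.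
  exact: cvg_sub (class_oo _) Oma XU.
rewrite fa => /(_ V nV) VX.
have [|Vinf|e0 He0] := @eventually_standard_class (X @^-1` V) h h0.
- case: VX => N _ HN; exists N => // n /= Nn Vnh.
  by have := HN (n + h)%N; rewrite /= addnK; apply;
    rewrite // (leq_trans Nn) ?leq_addr.
- by have [x []] := accumulation_cluster Oma (A := ~` V) Vinf nV.
- by exists e0; apply: VF; first exact: class_oo.
Qed.

(** * Limits along the residue classes modulo the least period *)

Section Phases.
Variables (a : T) (h e0 : nat).
Hypothesis Oma : Om a.
Hypothesis h_gt0 : (0 < h)%N.
Hypothesis iterh : iter h f a = a.
Hypothesis h_min : forall k, (0 < k)%N -> iter k f a = a -> (h <= k)%N.
Hypothesis Xe0 : X @ within (standard_class h e0) \oo --> a.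

(** Iterates cannot be cancelled, so a coincidence at [i' < j' < h] is pushed forward by [h - j']
    steps. This returns [a] to itself after [h - j' + i' < h] steps, against minimality. *)
Lemma iter_eq_mod i j : iter i f a = iter j f a <-> i = j %[mod h].
Proof.
have iter_mod k : iter k f a = iter (k %% h) f a.
  rewrite [in LHS](divn_eq k h) addnC iterD iterM; congr iter.
  by elim: (k %/ h)%N => //= m ->.
have iter_lt i' j' : (i' < j')%N -> (j' < h)%N -> iter i' f a <> iter j' f a.
  move=> ij jh ijE; have /h_min : iter (h - j' + i') f a = a.
    by rewrite iterD ijE -iterD subnK // ltnW.
  rewrite addn_gt0 subn_gt0 jh => /(_ isT); apply/negP.
  by rewrite -ltnNge -ltn_subRL subKn // ltnW.
split=> [|ijh]; last by rewrite iter_mod ijh -iter_mod.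
rewrite iter_mod [RHS]iter_mod.
case: (ltngtP (i %% h) (j %% h)) => // [ij|ji] ijE; exfalso.
  by apply: iter_lt ijE => //; rewrite ltn_mod.
by apply: (iter_lt _ _ ji) => //; rewrite ltn_mod.
Qed.

(** Adding [k] carries the class of [e] into that of [e0], and [cvg_sub] gives the limit [k] steps
    back from there. *)
Lemma cvg_phase e k : e + k = e0 %[mod h] ->
  X @ within (standard_class h e) \oo --> iter k f a.
Proof.
move=> eke0.
have : X (n - k)%N @[n --> within (standard_class h e0) \oo] --> iter k f a.
  by apply: cvg_sub Oma Xe0; exact: cvg_within.
suff addk : (n + k)%N @[n --> within (standard_class h e) \oo] -->
    within (standard_class h e0) \oo.
  move=> /(cvg_comp _ _ addk); rewrite (_ : _ \o _ = X) //.
  by apply/funext => n /=; rewrite addnK.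
move=> A [N _ NA]; exists N => // n /= Nn ne.
apply: NA; first by rewrite /= (leq_trans Nn) ?leq_addr.
by rewrite /standard_class /= -modnDml ne modnDml.
Qed.

(* The index k = e0 + (h - 1) * e satisfies e + k = e0 mod h. *)
Definition phase e := iter (e0 + h.-1 * e) f a.

Lemma phaseE e k : e + k = e0 %[mod h] -> phase e = iter k f a.
Proof.
move=> ek; apply/iter_eq_mod.
apply/eqP; rewrite -(eqn_modDl e) ek addnCA -mulSn prednK //.
by rewrite addnC mulnC modnMDl.
Qed.

Lemma cvg_standard_class e : X @ within (standard_class h e) \oo --> phase e.
Proof.
by apply: cvg_phase; rewrite addnCA -mulSn prednK // addnC mulnC modnMDl.
Qed.

Lemma phase_eq e e' : phase e = phase e' <-> e = e' %[mod h].
Proof.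
rewrite /phase iter_eq_mod; split => /eqP; rewrite ?eqn_modDl => /eqP ee'.
  (* Modulo [h], the factor [h.-1] acts as -1, so it can be cancelled. *)
  have : (h.-1 * e) + e = h.-1 * e' + e' %[mod h].
    by rewrite -!mulSnr prednK // !modnMr.
  move/eqP; rewrite -modnDml ee' modnDml eqn_modDl => /eqP //.
by apply/eqP; rewrite eqn_modDl -modnMmr ee' modnMmr.
Qed.

(** The number of iterations is [e0 - e] modulo [h], so one more application of [f] lowers the class
    by one. *)
Lemma phase_f e e' : e = e'.+1 %[mod h] -> f (phase e) = phase e'.
Proof.
move=> ee'; rewrite -[f _]/(iter (e0 + h.-1 * e).+1 f a) -(@phaseE e') //.
have -> : (e' + (e0 + h.-1 * e).+1 = e0 + (e'.+1 + h.-1 * e))%N by lia.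
by rewrite -modnDmr -(modnDml e'.+1) -ee' modnDml -mulSn prednK // modnMr addn0.
Qed.

Lemma cvg_arithmetic e : X (e + h * n)%N @[n --> \oo] --> phase e.
Proof.
have arith : (e + h * n)%N @[n --> \oo] --> within (standard_class h e) \oo.
  move=> A [N _ NA]; exists N => // n /= Nn; apply: NA.
    by rewrite /= (leq_trans Nn) // (leq_trans (leq_pmull _ h_gt0)) ?leq_addl.
  by rewrite /standard_class /= addnC mulnC modnMDl.
exact: (cvg_comp (fun n => e + h * n)%N X arith (cvg_standard_class (e := e))).
Qed.

(** A point [b] off the orbit can be separated from each of the [h] limits. The intersection of the
    resulting neighbourhoods of [b] is eventually avoided by [X], so [b] is not a cluster point. *)
Lemma accumulation_phase : Om = range phase.
Proof.
apply/seteqP; split => [b Omb|_ [e _ <-]]; last exact: accumulation_iter.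
apply: contrapT => nb.
have /choice[A AP] (i : 'I_h) : exists A : set T,
    nbhs b A /\ \forall n \near \oo, standard_class h i n -> ~ A (X n).
  have : phase i <> b by move=> ib; apply: nb; exists i.
  apply: contra_notP => /forallNP noA; apply: hausT => B A nB nA.
  have := noA A; rewrite not_andP => -[//|nAX].
  apply: contrapT => BA0; apply: nAX.
  apply: (@filterS _ \oo _ _ _ _ (@cvg_standard_class i _ nB)) =>
    n BX /BX BXn AXn.
  by apply: BA0; exists (X n).
have nAi : nbhs b [set x | forall i : 'I_h, A i x].
  by apply: filter_forall => i; case: (AP i).
have nAX : \forall n \near \oo, forall i : 'I_h, standard_class h i n ->
  ~ A i (X n).
  by apply: filter_forall => i; case: (AP i).
have [|x [xn xA]] :=
  accumulation_cluster Omb (A := [set x | exists i, ~ A i x]) _ nAi.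
  apply: filterS nAX => n /(_ (Ordinal (ltn_pmod n h_gt0))) nAX.
  by exists (Ordinal (ltn_pmod n h_gt0)); apply: nAX;
    rewrite /standard_class /= modn_mod.
by case: xn => i; apply.
Qed.

Lemma range_phase_I : phase @` `I_h = range phase.
Proof.
apply/seteqP; split => _ [e _ <-]; first by exists e.
by exists (e %% h)%N; [rewrite /= ltn_mod|apply/phase_eq; rewrite modn_mod].
Qed.

Lemma card_accumulation : (Om #= `I_h)%card.
Proof.
rewrite accumulation_phase -range_phase_I inj_card_eq // => i j.
rewrite !inE /= => ih jh /phase_eq.
by rewrite !modn_small.
Qed.

(** There are finitely many classes, so eventually [X n] lies in [V (phase n)]. Disjointness of [V]
    then determines [phase n], and [phase_eq] recovers the class of [n]. *)
Lemma near_nbhs_phase V e : disjoint_open_nbhs Om V ->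
  \forall n \near \oo, V (phase e) (X n) <-> standard_class h e n.
Proof.
move=> [V_open V_disj].
have Omph i : Om (phase i) by rewrite accumulation_phase; exists i.
have VX : \forall n \near \oo, forall i : 'I_h, standard_class h i n ->
  V (phase i) (X n).
  apply: filter_forall => i; apply: (@cvg_standard_class i).
  by apply: open_nbhs_nbhs; apply: V_open.
apply: filterS VX => n /(_ (Ordinal (ltn_pmod n h_gt0))).
rewrite /standard_class /= modn_mod => /(_ erefl).
rewrite (_ : phase (n %% h) = phase n) => [VX|]; last first.
  by apply/phase_eq; rewrite modn_mod.
split=> [VeX|/phase_eq <- //]; apply/phase_eq.
by apply: V_disj => //; exists (X n).
Qed.

(** Each index set is eventually a single residue class modulo [h]. All the periods therefore equal
    [h], and so does their least common multiple. *)
Lemma finite_rational_accumulation_phase : finite_rational_accumulation X Om h.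
Proof.
have finOm : finite_set Om by apply/finite_setP; exists h;
  exact: card_accumulation.
have [V Vsep] := separating_open_nbhs hausT finOm.
have nearV b : Om b -> exists e, \forall n \near \oo, V b (X n) <->
  standard_class h e n.
  by rewrite accumulation_phase => -[e _ <-]; exists e; exact: near_nbhs_phase.
split=> //; exists V; split=> //; last first.
  apply: partition_period_const => // [|b /nearV[e]]; first by exists a.
  exact: period_standard.
split=> // [b /nearV[e Ve]|].
  exact: rational_eventual_period (eventual_period_standard h_gt0 Ve).
have : \forall n \near \oo, forall i : 'I_h, V (phase i) (X n) <->
  standard_class h i n.
  by apply: filter_forall => i; exact: near_nbhs_phase.
(* The exceptional set is the initial segment below a threshold common to all classes. *)
move=> [N _ NV]; exists `I_N; split; first exact: finite_II.
  move=> b c Omb Omc [n [[Vb _] [Vc _]]].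
  by apply: Vsep.2 => //; exists (X n).
apply/seteqP; split => [n /= /negP|n [b _ []] //].
rewrite -leqNgt => Nn; pose i := Ordinal (ltn_pmod n h_gt0).
exists (phase i); first by rewrite accumulation_phase; exists i.
split; last by apply/negP; rewrite -leqNgt.
by apply/(NV n Nn i); rewrite /standard_class /= modn_mod.
Qed.

End Phases.

End Dynamics.

(** * Compactness and continuity for formal power series *)

Section Complex.
Variable R : realType.
Local Open Scope complex_scope.

Lemma Complex_continuous : continuous (fun p : R * R => (p.1 +i* p.2 : R[i])).
Proof.
move=> [x y]; apply/cvg_ballP => -[e e'].
(* Radii of balls in [R[i]] are complex; positivity forces the imaginary part to be zero. *)
rewrite ltcE /= => /andP[/eqP -> e0].
have e20 : 0 < e / 2 by rewrite divr_gt0.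
near=> p.
have [px py] : `|x - p.1| < e / 2 /\ `|y - p.2| < e / 2.
  by near: p; exists (ball x (e / 2), ball y (e / 2)) => [|[]//]; split;
    exact: nbhsx_ballx.
change (`|(x +i* y : R[i]) - (p.1 +i* p.2)| < e%:C).
rewrite normc_def ltcR /= -[ltRHS]ger0_norm ?ltW // -sqrtr_sqr ltr_sqrt
  ?exprn_gt0 //.
have -> : e ^+ 2 = 4 * (e / 2) ^+ 2 by field.
have sq (r : R) : `|r| < e / 2 -> r ^+ 2 < (e / 2) ^+ 2.
  by move=> re; rewrite -real_normK ?num_real // ltrXn2r ?ltr0n.
by have := sq _ px; have := sq _ py; have := exprn_gt0 2 e20; lra.
Unshelve. all: by end_near. Qed.

Lemma compact_complex_square (M : R) :
  compact [set z : R[i] | `|complex.Re z| <= M /\ `|complex.Im z| <= M].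
Proof.
have -> : [set z : R[i] | `|complex.Re z| <= M /\ `|complex.Im z| <= M] =
    (fun p : R * R => p.1 +i* p.2) @` (`[- M, M] `*` `[- M, M]).
  apply/seteqP; split => [[x y] /= [xM yM]|_ [[x y] /= [xM yM] <-]] /=.
    by exists (x, y); rewrite //= !in_itv /= -!ler_norml.
  by move: xM yM; rewrite /= !in_itv /= -!ler_norml.
apply: continuous_compact; first exact/continuous_subspaceT/Complex_continuous.
by apply: compact_setX; exact: segment_compact.
Qed.

Lemma normc_le_Re_Im (z : R[i]) (M : R) : `|z| <= M%:C ->
  `|complex.Re z| <= M /\ `|complex.Im z| <= M.
Proof.
rewrite normc_def lecR => zM; split; apply: le_trans zM.
  by rewrite -sqrtr_sqr ler_sqrt ?lerDl ?addr_ge0 ?sqr_ge0.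
by rewrite -sqrtr_sqr ler_sqrt ?lerDr ?addr_ge0 ?sqr_ge0.
Qed.

End Complex.

Lemma fmap_ultra (T U : Type) (f : T -> U) (F : set_system T) :
  UltraFilter F -> UltraFilter (f @ F).
Proof.
move=> FU; split; first exact: fmap_proper_filter.
move=> G PG FG; apply/seteqP; split => // A GA.
have [//|nFA] := in_ultra_setVsetC (f @^-1` A) FU.
by have [x []] := filter_ex (filterI GA (FG (~` A) nFA)).
Qed.

Section OppositeSequence.
Variable R : realType.
Local Open Scope complex_scope.

Lemma hausdorff_fps : hausdorff_space (fps R).
Proof.
by apply: hausdorff_product => _; exact: (@norm_hausdorff _ R[i]^o).
Qed.

Lemma fps_cvg (F : set_system (fps R)) (b : fps R) : Filter F ->
  (forall k : nat, g k @[g --> F] --> b k) -> F --> b.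
Proof. by move=> FF; exact: (pointwise_cvgP b FF).2. Qed.

Lemma nbhs_fps_coef (b : fps R) (k : nat) (U : set R[i]) : nbhs (b k) U ->
  nbhs b [set g : fps R | U (g k)].
Proof. exact: (@proj_continuous nat (fun=> R[i]) k b U). Qed.

Lemma nbhs_ball_fps_coef (b : fps R) (k : nat) (e : R) : 0 < e ->
  nbhs b [set g : fps R | ball (b k) e%:C (g k)].
Proof.
by move=> e0; apply: nbhs_fps_coef; apply: nbhsx_ballx; rewrite ltcR.
Qed.

Lemma tau_continuous (b : fps R) : b 1%N != 0 -> {for b, continuous (@tau R)}.
Proof.
move=> b1; apply: (@fps_cvg (@tau R @ nbhs b)) => k.
have coef_cvg m : (fun g : fps R => g m) @ nbhs b --> (b m : R[i]).
  by move=> U; exact: nbhs_fps_coef.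
exact: cvgM (coef_cvg k.+1) (cvgV b1 (coef_cvg 1%N)).
Qed.

Lemma tau_opposite_seq (P : fps R) (n : nat) : P n.+1 != 0 ->
  tau (opposite_seq P n.+1) = opposite_seq P n.
Proof.
move=> Pn0; apply/funext => k; rewrite /tau /opposite_seq ltnS /= subSS.
case: ifP => _; last by rewrite mul0r.
by rewrite subSS subn0 invf_div mulrA mulfVK.
Qed.

Lemma opposite_seqS (P : fps R) (n k : nat) : P n != 0 ->
  opposite_seq P n.+1 k.+1 = opposite_seq P n k * (P n / P n.+1).
Proof.
move=> Pn0; rewrite /opposite_seq ltnS subSS.
by case: ifP => _; rewrite ?mul0r // mulrA mulfVK.
Qed.

(** Coefficientwise convergence is tested by the countable family [B m], which constrains the first
    [m] coefficients to within [1 / (m + 1)]. A subsequence can thus be extracted from a cluster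
    point. *)
Lemma accumulation_fps (X : nat -> fps R) (b : fps R) :
  cluster (X @ \oo) b -> accumulation_points X b.
Proof.
move=> cb.
pose B m := [set g : fps R | forall k : 'I_m, ball (b k) (m.+1%:R^-1)%:C (g k)].
have nB m : nbhs b (B m).
  apply: (@filter_forall _ _ _ (nbhs b)) => k.
  by apply: nbhs_ball_fps_coef; rewrite invr_gt0 ltr0n.
have /choice[phi0 phi0P] (p : nat * nat) : exists n, (p.2 < n)%N /\ B p.1 (X n).
  have [|g [[n pn <-] Bg]] :=
    cb (X @` [set n | (p.2 < n)%N]) (B p.1) _ (nB p.1).
    by exists p.2.+1 => // n /= ?; exists n.
  by exists n.
(* In [phi0 (m, l)], [m] selects the neighbourhood and [l] is the index to exceed; taking [l] to be
   the previous index makes [phi] increasing. *)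
pose phi := fix phi m := if m is m'.+1 then phi0 (m, phi m') else phi0 (0, 0).
have phiB m : B m (X (phi m)).
  by case: m => [|m] /=; [case: (phi0P (0, 0)%N)|case: (phi0P (m.+1, phi m))].
exists phi.
  by apply/increasing_seqP => m; rewrite ltEnat /=; case: (phi0P (m.+1, phi m)).
apply: (@fps_cvg ((X \o phi) @ \oo)) => k.
suff : (fun m => X (phi m) k) @ \oo --> (b k : R[i]) by [].
apply/cvg_ballP => -[e e'].
rewrite ltcE /= => /andP[/eqP -> e0].
near=> m.
have km : (k < m)%N by near: m; exact: nbhs_infty_gt.
apply: (le_ball _ (phiB m (Ordinal km))).
rewrite lecR invf_ple ?posrE ?ltr0n//.
by rewrite ltW//; near: m; apply: filterS (nbhs_infty_gtr e^-1) =>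
  m /= /lt_le_trans; apply; rewrite ler_nat.
Unshelve. all: by end_near. Qed.

(** * Bounds and cluster points for a tame series *)

Variable P : fps R.
Hypothesis tameP : tame P.

Lemma tame_neq0 : \forall n \near \oo, P n != 0.
Proof.
have [u [v [u0 v0 Puv]]] := tameP; apply: filterS Puv => n /andP[uP _].
apply: contraTneq uP => ->; rewrite invr0 mulr0 normr0.
by rewrite -[0]/(0%:C) lecR -ltNge.
Qed.

(** For large [n], coefficient [k] is a product of [k] successive ratios [P n.-1 / P n], each of
    modulus at most [v]; hence the bound [v ^+ k]. *)
Lemma opposite_seq_bounded (k : nat) : exists M : R,
  \forall n \near \oo, `|opposite_seq P n k| <= M%:C.
Proof.
have [u [v [u0 v0 Puv]]] := tameP; exists (v ^+ k).
elim: k => [|k IHk].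
  apply: filterS tame_neq0 => n Pn0; rewrite /opposite_seq leq0n subn0 divff //.
  by rewrite normr1 expr0.
case: IHk => N1 _ H1; case: Puv => N2 _ H2; case: tame_neq0 => N3 _ H3.
exists (N1 + N2 + N3).+1 => // -[//|n] /=; rewrite ltnS => Nn.
have [n1 n2 n3] : [/\ N1 <= n, N2 <= n.+1 & N3 <= n]%N by split; lia.
rewrite opposite_seqS ?(H3 n n3) // normrM exprSr rmorphM ler_pM //;
  first exact: H1.
by have /andP[] := H2 _ n2.
Qed.

(** Coefficient 1 of the [n]-th term is [P n.-1 / P n], eventually of modulus at least [u], so it
    cannot come within [u] of zero. *)
Lemma Omega_coef1_neq0 (b : fps R) : Omega P b -> b 1%N != 0.
Proof.
move=> /accumulation_cluster cb; apply/negP => /eqP b1.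
have [u [v [u0 v0 Puv]]] := tameP.
have [|g [uX gb]] :=
  cb [set g | u%:C <= `|g 1%N|] _ _ (nbhs_ball_fps_coef b 1 u0).
  case: Puv => N1 _ H1; exists N1.+1 => // -[//|n] /=; rewrite ltnS => Nn.
  by rewrite /opposite_seq /= subn1; have /andP[] := H1 n.+1 (leqW Nn).
have : `|b 1%N - g 1%N| < u%:C by exact: gb.
by rewrite b1 sub0r normrN => /(le_lt_trans uX); rewrite ltxx.
Qed.

(* Tychonoff's argument: an ultrafilter finer than the image of F converges in
   each coordinate. *)
Lemma opposite_seq_cluster (F : set_system nat) : ProperFilter F ->
  F --> \oo ->
  exists2 b, Omega P b & cluster (opposite_seq P @ F) b.
Proof.
move=> PF Foo.
have [G [UG FG]] := ultraFilterLemma (fmap_proper_filter (opposite_seq P) PF).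
have /choice[b Gb] (k : nat) :
    exists z : R[i], (fun g : fps R => g k) @ G --> z.
  have [M XM] := opposite_seq_bounded k.
  have := @compact_complex_square R M; rewrite compact_ultra.
  move=> Kultra; have GK : G [set g : fps R | `|complex.Re (g k)| <= M /\
    `|complex.Im (g k)| <= M].
    by apply: FG; apply: Foo; apply: filterS XM => n; exact: normc_le_Re_Im.
  by have [z [_ ?]] := Kultra _ (fmap_ultra (fun g : fps R => g k) UG) GK;
    exists z.
have {}Gb : G --> (b : fps R) by exact: fps_cvg.
have clb : cluster (opposite_seq P @ F) (b : fps R).
  move=> A B /FG GA /Gb GB; exact: (filter_ex (filterI GA GB)).
(* Since [F] is finer than [\oo], a cluster point along [F] is also one along [\oo], hence the limit
   of a subsequence. *)
exists (b : fps R) => //; apply: accumulation_fps => A B XA nB.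
by apply: clb => //; exact: Foo.
Qed.

Lemma near_tau_opposite_seq :
  \forall n \near \oo, tau (opposite_seq P n.+1) = opposite_seq P n.
Proof.
case: tame_neq0 => N _ HN; exists N => // n Nn.
by apply: tau_opposite_seq; apply: HN; rewrite /= leqW.
Qed.

End OppositeSequence.

(* Z/hP is represented by natural numbers modulo hP: the clauses on alpha say
   that e mod hP |-> alpha e is a well-defined bijection onto Omega P. *)
Theorem mainTheorem2 (R : realType) (P : fps R) (a : fps R)
    (tameP : tame P)
    (isolated_a : isolated (Omega P) a)
    (periodic_a : exists2 h : nat, (0 < h)%N & iter h (@tau R) a = a) :
  exists hP : nat,
    [/\ finite_rational_accumulation (opposite_seq P) (Omega P) hP,
        (Omega P #= `I_hP)%card,
        Omega P = [set iter k (@tau R) a | k in [set: nat]] &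
        exists alpha : nat -> fps R,
          [/\ forall e : nat,
                opposite_seq P (e + hP * n)%N @[n --> \oo] --> alpha e,
              (forall e e' : nat, alpha e = alpha e' <-> e = e' %[mod hP]) /\
              range alpha = Omega P,
              forall V : fps R -> set (fps R),
                disjoint_open_nbhs (Omega P) V ->
                forall e : nat,
                  eq_up_to_finite (opposite_seq P @^-1` V (alpha e))
                                  (standard_class hP e) &
              forall e e' : nat,
                e = e'.+1 %[mod hP] -> tau (alpha e) = alpha e']].
Proof.
have hausT := @hausdorff_fps R; have regT := @uniform_regular (fps R).
have Xcl := opposite_seq_cluster tameP.
have tauc b (Omb : Omega P b) := tau_continuous (Omega_coef1_neq0 tameP Omb).
have tauX := near_tau_opposite_seq tameP.
have Oma : Omega P a by case: isolated_a => /set_mem.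
(* The given period may be a proper multiple of the least one, and only the least counts the points
   of the orbit. *)
have exh : exists h, (0 < h)%N && `[< iter h (@tau R) a = a >].
  by case: periodic_a => h h0 ha; exists h; rewrite h0; apply/asboolP.
case: (ex_minnP exh) => h /andP[h0 /asboolP ha] min_h.
have h_min k : (0 < k)%N -> iter k (@tau R) a = a -> (h <= k)%N.
  by move=> k0 ka; apply: min_h; rewrite k0; apply/asboolP.
have [e0 Xe0] := isolated_periodic_phase regT Xcl tauc tauX isolated_a h0 ha.
have OmE : Omega P = range (phase (@tau R) a h e0).
  exact: (accumulation_phase hausT tauc tauX Oma h0 Xe0).
exists h; split.
- exact: (finite_rational_accumulation_phase hausT tauc tauX Oma h0 ha h_min
  Xe0).
- exact: (card_accumulation hausT tauc tauX Oma h0 ha h_min Xe0).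
- apply/seteqP; split => [b|_ [k _ <-]].
    by rewrite OmE => -[e _ <-]; exists (e0 + h.-1 * e)%N.
  exact: (accumulation_iter tauc tauX k Oma).
- exists (phase (@tau R) a h e0); split => [e||V sepV e|e e'].
  + by apply: (cvg_arithmetic tauc tauX Oma h0 Xe0).
  + by split; [exact: phase_eq|rewrite OmE].
  + apply: near_eq_up_to_finite.
    exact: (near_nbhs_phase hausT tauc tauX Oma h0 ha h_min Xe0).
  + exact: phase_f.
Qed.
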